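(* Let $q$ be a prime power. If $\alpha\in\mathcal{T}_q$ is nonconstant, then $h(\alpha)\geq\frac{1}{q+1}$. Moreover, there exists $\alpha\in\mathcal{T}_q$ of degree $[\mathbb{F}_q(T)(\alpha):\mathbb{F}_q(T)]=q+1$ and height $h(\alpha)=\frac{1}{q+1}$.
   Context: $\mathbb{F}_q$ is the finite field with $q$ elements, $\mathbb{F}_q(T)$ the rational function field over it, $\overline{\mathbb{F}_q(T)}$ a fixed algebraic closure, and $\mathbb{F}_q((T))$ the field of formal Laurent series. The minimal polynomial of $\alpha\in\overline{\mathbb{F}_q(T)}$ is the unique polynomial $f\in\mathbb{F}_q[T][x]$ that is irreducible over $\mathbb{F}_q(T)$ as a polynomial in $x$, satisfies $f(\alpha)=0$, has coefficients in $\mathbb{F}_q[T]$ with no common factor, and whose leading coefficient (in $x$) is a monic polynomial in $T$. The height is $h(\alpha)=\deg_T(f)/\deg_x(f)$. An element $\alpha$ is totally $T$-adic if its minimal polynomial splits completely (into linear factors in $x$) over $\mathbb{F}_q((T))$; $\mathcal{T}_q$ denotes the set of all totally $T$-adic elements of $\overline{\mathbb{F}_q(T)}$. An element is constant if it is algebraic over $\mathbb{F}_q$, and nonconstant otherwise. *)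

(* Defs.v *)
From HB Require Import structures.
From mathcomp Require Import all_boot all_order all_algebra.
From mathcomp Require Import boolp classical_sets cardinality fsbigop.
From mathcomp Require Import zify ring.

Set Implicit Arguments.
Unset Strict Implicit.
Unset Printing Implicit Defensive.

Import Order.TTheory GRing.Theory Num.Theory.

Local Open Scope ring_scope.

Section CauchyProduct.
Variable F : fieldType.
Implicit Types a b c : int -> F.

Definition zero_below (N : int) a := forall n, n < N -> a n = 0.

Definition bounded_below a := exists N, zero_below N a.

(* The big operator ranges over the support of the summand, which is finite
   when [a] and [b] are both bounded below. *)
Definition cauchy_prod a b : int -> F :=
  fun n => \sum_(i \in [set: int]) a i * b (n - i).

Definition laurent_trunc (N : int) (K : nat) a : {poly F} :=
  \poly_(k < K) a (N + k%:Z).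

Local Notation tr := laurent_trunc.

Lemma zero_below_le a (M N : int) :
  M <= N -> zero_below N a -> zero_below M a.
Proof. by move=> leMN aN n nM; apply: aN; apply: lt_le_trans leMN. Qed.

Lemma cauchy_prod_zero_below a b A B :
  zero_below A a -> zero_below B b -> zero_below (A + B) (cauchy_prod a b).
Proof.
move=> aA bB n nAB; apply: fsbig1 => i _.
have [iA|Ai] := ltP i A; first by rewrite aA // mul0r.
by rewrite bB ?mulr0 //; lia.
Qed.

Lemma cauchy_prodE A B a b (k K : nat) :
  zero_below A a -> zero_below B b -> (k < K)%N ->
  cauchy_prod a b (A + B + k%:Z) = (tr A K a * tr B K b)`_k.
Proof.
move=> aA bB kK; rewrite /cauchy_prod.
rewrite (fsbigE [seq A + j%:Z | j <- iota 0 k.+1]).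
- rewrite big_map -/(index_iota 0 k.+1) coefM -(big_mkord xpredT
    (fun j => (tr A K a)`_j * (tr B K b)`_(k - j))).
  rewrite big_nat_cond [RHS]big_nat_cond.
  apply: eq_big => [j|j /andP[/andP[_ jk] _]]; first by rewrite in_setT.
  rewrite !coef_poly ifT; last by lia.
  by rewrite ifT; [congr (_ * b _); lia | lia].
- by rewrite map_inj_uniq ?iota_uniq // => x y; lia.
- by [].
- move=> i _ iI; have [iA|Ai] := ltP i A; first by rewrite aA // mul0r.
  have [ik|ki] := leP i (A + k%:Z); last by rewrite bB ?mulr0 //; lia.
  case/negP: iI; apply/mapP; exists `|i - A|%N; last by lia.
  by rewrite mem_iota; lia.
Qed.

Lemma cauchy_prod_trunc A B a b (K : nat) :
  zero_below A a -> zero_below B b ->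
  tr (A + B) K (cauchy_prod a b) = take_poly K (tr A K a * tr B K b).
Proof.
move=> aA bB; apply/polyP => k; rewrite coef_poly coef_take_poly.
by case: ifP => // kK; rewrite (cauchy_prodE aA bB kK).
Qed.

Lemma coefM_take (K k : nat) (p q : {poly F}) : (k < K)%N ->
  (p * take_poly K q)`_k = (p * q)`_k.
Proof.
move=> kK; rewrite !coefM; apply: eq_bigr => j _; rewrite coef_take_poly ifT //.
by lia.
Qed.

Lemma zero_below_eq N a b : zero_below N a -> zero_below N b ->
  (forall k : nat, a (N + k%:Z) = b (N + k%:Z)) -> a = b.
Proof.
move=> aN bN eab; apply/funext => n; have [nN|Nn] := ltP n N.
  by rewrite aN // bN.
by have := eab `|n - N|%N; have -> : N + `|n - N|%N%:Z = n by lia.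
Qed.

Lemma cauchy_prodC a b : bounded_below a -> bounded_below b ->
  cauchy_prod a b = cauchy_prod b a.
Proof.
move=> [A aA] [B bB]; apply: (@zero_below_eq (A + B)).
- exact: cauchy_prod_zero_below.
- by rewrite addrC; exact: cauchy_prod_zero_below.
- move=> k; rewrite (cauchy_prodE aA bB (ltnSn k)).
  by rewrite [A + B]addrC (cauchy_prodE bB aA (ltnSn k)) mulrC.
Qed.

Lemma cauchy_prodA a b c :
  bounded_below a -> bounded_below b -> bounded_below c ->
  cauchy_prod a (cauchy_prod b c) = cauchy_prod (cauchy_prod a b) c.
Proof.
move=> [A aA] [B bB] [C cC].
have abz := cauchy_prod_zero_below aA bB.
have bcz := cauchy_prod_zero_below bB cC.
have l := cauchy_prod_zero_below aA bcz.
have r := cauchy_prod_zero_below abz cC.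
apply: (zero_below_eq l); first by rewrite addrA.
move=> k; have kk := ltnSn k.
rewrite (cauchy_prodE aA bcz kk) (cauchy_prod_trunc _ bB cC) coefM_take //.
rewrite addrA (cauchy_prodE abz cC kk) (cauchy_prod_trunc _ aA bB).
by rewrite [in RHS]mulrC coefM_take // mulrA mulrC.
Qed.

Lemma cauchy_prodDl a b c :
  bounded_below a -> bounded_below b -> bounded_below c ->
  cauchy_prod (fun n => a n + b n) c =
  (fun n => cauchy_prod a c n + cauchy_prod b c n).
Proof.
move=> [A aA] [B bB] [C cC]; pose M := Num.min A B.
have aM : zero_below M a by apply: zero_below_le aA; rewrite ge_min lexx.
have bM : zero_below M b by apply: zero_below_le bB; rewrite ge_min lexx orbT.
have abM : zero_below M (fun n => a n + b n).
  by move=> n nM; rewrite aM // bM // addr0.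
apply: (zero_below_eq (cauchy_prod_zero_below abM cC)) => [n nM|k].
  by rewrite !(@cauchy_prod_zero_below _ _ M C) // addr0.
have kk := ltnSn k.
rewrite (cauchy_prodE abM cC kk) (cauchy_prodE aM cC kk) (cauchy_prodE bM cC kk).
rewrite -coefD -mulrDl; congr ((_ * _ : {poly F})`__); apply/polyP => i.
by rewrite coefD !coef_poly; case: ifP => // _; rewrite addr0.
Qed.

Definition cauchy_one : int -> F := fun n => (n == 0)%:R.

Lemma cauchy_one_zero_below : zero_below 0 cauchy_one.
Proof. by move=> n n0; rewrite /cauchy_one lt_eqF. Qed.

Lemma trunc_cauchy_one K : tr 0 K.+1 cauchy_one = 1.
Proof.
apply/polyP => -[|i]; rewrite coef_poly coef1 /cauchy_one //=.
by case: ifP.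
Qed.

Lemma cauchy_prod1 a : bounded_below a -> cauchy_prod cauchy_one a = a.
Proof.
move=> [A aA]; have o := cauchy_one_zero_below.
apply: (zero_below_eq (cauchy_prod_zero_below o aA)); first by rewrite add0r.
move=> k; rewrite (cauchy_prodE o aA (ltnSn k)) trunc_cauchy_one mul1r.
by rewrite coef_poly ltnSn add0r.
Qed.

Fixpoint inv_coefs (u : nat -> F) (K : nat) : seq F :=
  if K is k.+1 then
    let s := inv_coefs u k in
    rcons s (((k == 0)%:R - \sum_(j < k) s`_j * u (k - j)%N) / u 0%N)
  else [::].

Lemma size_inv_coefs u K : size (inv_coefs u K) = K.
Proof. by elim: K => //= K IH; rewrite size_rcons IH. Qed.

Lemma nth_inv_coefs u K j : (j < K)%N -> (inv_coefs u K)`_j = (inv_coefs u j.+1)`_j.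
Proof.
elim: K => //= K IH; rewrite ltnS leq_eqVlt => /orP[/eqP -> //|jK].
rewrite nth_rcons size_inv_coefs jK IH //=.
Qed.

Lemma cauchy_inv a : bounded_below a -> a <> (fun=> 0) ->
  exists b, bounded_below b /\ cauchy_prod b a = cauchy_one.
Proof.
move=> [N aN] a0.
have exk : exists k : nat, a (N + k%:Z) != 0.
  apply: contrapT => nex; apply: a0; apply: (@zero_below_eq N) => // k.
  by apply/eqP; apply: contrapT => /negP nz; apply: nex; exists k.
case: (ex_minnP exk) => m am mmin; pose A := N + m%:Z.
have aA : zero_below A a.
  move=> n nA; have [nN|Nn] := ltP n N; first exact: aN.
  apply/eqP; apply: contraT => an.
  have := mmin `|n - N|%N; have -> : N + `|n - N|%N%:Z = n by lia.
  by move=> /(_ an); lia.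
pose u k := a (A + k%:Z).
have u0 : u 0%N != 0 by rewrite /u addr0.
pose v k := (inv_coefs u k.+1)`_k.
pose b (n : int) := if n + A < 0 then 0 else v (absz (n + A)).
have bB : zero_below (- A) b by move=> n nA; rewrite /b ifT //; lia.
exists b; split; first by exists (- A).
apply: (zero_below_eq (cauchy_prod_zero_below bB aA)) => [|k].
  by rewrite addNr; apply: cauchy_one_zero_below.
have bE (j : nat) : b (- A + j%:Z) = v j.
  rewrite /b ifF; last by lia.
  by congr v; lia.
rewrite (cauchy_prodE bB aA (ltnSn k)) coefM big_ord_recr /= subnn !coef_poly.
rewrite !ltnSn /= bE -/(u 0%N).
rewrite [X in _ + X * _]/v /= nth_rcons size_inv_coefs ltnn eqxx divfK //.
rewrite (eq_bigr (fun j : 'I_k => (inv_coefs u k)`_j * u (k - j)%N)) => [|j _].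
  by rewrite addrC subrK /cauchy_one; congr (_%:R); case: k; lia.
rewrite !coef_poly (ltn_trans (ltn_ord j)) // ltnS leq_subr bE.
by rewrite /v (nth_inv_coefs _ (ltn_ord j)).
Qed.
End CauchyProduct.

Section LaurentField.
Variable F : fieldType.

(* [lcoef x n] is the coefficient of T^n in x. *)
Record laurent := Laurent {
  lcoef : int -> F;
  _ : `[< bounded_below lcoef >] }.

HB.instance Definition _ := [isSub for lcoef].
HB.instance Definition _ := [Choice of laurent by <:].

Implicit Types x y z : laurent.

Lemma lcoef_bounded x : bounded_below (lcoef x).
Proof. by case: x => a /= /asboolP. Qed.

Lemma lcoef_inj : injective lcoef.
Proof. exact: val_inj. Qed.

Definition mk_laurent a (bnd : bounded_below a) : laurent :=
  Laurent (asboolT bnd).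

Fact laurent0_subproof : bounded_below (fun=> 0 : F).
Proof. by exists 0. Qed.

Fact laurent_opp_subproof x : bounded_below (fun n => - lcoef x n).
Proof. by have [N xN] := lcoef_bounded x; exists N => n /xN ->; rewrite oppr0. Qed.

Fact laurent_add_subproof x y : bounded_below (fun n => lcoef x n + lcoef y n).
Proof.
have [[M xM] [N yN]] := (lcoef_bounded x, lcoef_bounded y).
exists (Num.min M N) => n; rewrite lt_min => /andP[/xM -> /yN ->].
by rewrite addr0.
Qed.

Fact laurent1_subproof : bounded_below (cauchy_one F).
Proof. by exists 0; apply: cauchy_one_zero_below. Qed.

Fact laurent_mul_subproof x y : bounded_below (cauchy_prod (lcoef x) (lcoef y)).
Proof.
have [[M xM] [N yN]] := (lcoef_bounded x, lcoef_bounded y).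
by exists (M + N); apply: cauchy_prod_zero_below.
Qed.

Definition laurent0 := mk_laurent laurent0_subproof.
Definition laurent_opp x := mk_laurent (laurent_opp_subproof x).
Definition laurent_add x y := mk_laurent (laurent_add_subproof x y).
Definition laurent1 := mk_laurent laurent1_subproof.
Definition laurent_mul x y := mk_laurent (laurent_mul_subproof x y).
Definition laurent_inv x :=
  xget laurent0 [set y | laurent_mul y x = laurent1]%classic.

Fact laurent_addA : associative laurent_add.
Proof. by move=> x y z; apply/lcoef_inj/funext => n /=; rewrite addrA. Qed.

Fact laurent_addC : commutative laurent_add.
Proof. by move=> x y; apply/lcoef_inj/funext => n /=; rewrite addrC. Qed.

Fact laurent_add0 : left_id laurent0 laurent_add.
Proof. by move=> x; apply/lcoef_inj/funext => n /=; rewrite add0r. Qed.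

Fact laurent_addN : left_inverse laurent0 laurent_opp laurent_add.
Proof. by move=> x; apply/lcoef_inj/funext => n /=; rewrite addNr. Qed.

HB.instance Definition _ := GRing.isZmodule.Build laurent
  laurent_addA laurent_addC laurent_add0 laurent_addN.

Fact laurent_mulA : associative laurent_mul.
Proof. by move=> x y z; apply/lcoef_inj/cauchy_prodA; apply: lcoef_bounded. Qed.

Fact laurent_mulC : commutative laurent_mul.
Proof. by move=> x y; apply/lcoef_inj/cauchy_prodC; apply: lcoef_bounded. Qed.

Fact laurent_mul1 : left_id laurent1 laurent_mul.
Proof. by move=> x; apply/lcoef_inj/cauchy_prod1/lcoef_bounded. Qed.

Fact laurent_mulDl : left_distributive laurent_mul laurent_add.
Proof. by move=> x y z; apply/lcoef_inj/cauchy_prodDl; apply: lcoef_bounded. Qed.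

Fact laurent1_neq0 : laurent1 != laurent0.
Proof.
apply/eqP => /(congr1 (fun x => lcoef x 0)) /eqP.
by rewrite /= /cauchy_one eqxx oner_eq0.
Qed.

HB.instance Definition _ := GRing.Zmodule_isComNzRing.Build laurent
  laurent_mulA laurent_mulC laurent_mul1 laurent_mulDl laurent1_neq0.

Fact laurent_mulV x : x != 0 -> laurent_inv x * x = 1.
Proof.
move=> x0; have xc0 : lcoef x <> (fun=> 0).
  by move=> xc; case/eqP: x0; apply: lcoef_inj.
have [b [bb ba]] := cauchy_inv (lcoef_bounded x) xc0.
apply: (@xgetI _ _ [set y | laurent_mul y x = laurent1]%classic (mk_laurent bb)).
exact/lcoef_inj.
Qed.

Fact laurent_inv0 : laurent_inv 0 = 0.
Proof.
apply: xgetPN => y /= y0; case/eqP: laurent1_neq0.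
by rewrite -y0; apply: (mulr0 y).
Qed.

HB.instance Definition _ := GRing.ComNzRing_isField.Build laurent
  laurent_mulV laurent_inv0.

Fact laurent_of_poly_subproof (p : {poly F}) :
  bounded_below (fun n => if n is Posz k then p`_k else 0).
Proof. by exists 0 => -[]. Qed.

Definition laurent_of_poly p : laurent := mk_laurent (laurent_of_poly_subproof p).

Fact laurent_of_poly_is_zmod_morphism : zmod_morphism laurent_of_poly.
Proof.
by move=> p q; apply/lcoef_inj/funext => -[k|k] /=; rewrite ?coefB ?subr0.
Qed.

Fact laurent_of_poly_is_monoid_morphism : monoid_morphism laurent_of_poly.
Proof.
split=> [|p q]; apply/lcoef_inj.
  by apply/funext => -[k|k] //=; rewrite coef1.
have z (r : {poly F}) : zero_below 0 (lcoef (laurent_of_poly r)) by case.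
apply: (zero_below_eq (z _)); first by rewrite -[0]addr0; apply: cauchy_prod_zero_below.
move=> k; have := cauchy_prodE (z p) (z q) (ltnSn k).
rewrite addr0 => e; apply: etrans (esym e); rewrite add0r /= !coefM.
apply: eq_bigr => j _; rewrite !coef_poly !add0r ltn_ord.
by rewrite ltnS leq_subr.
Qed.

HB.instance Definition _ := GRing.isZmodMorphism.Build {poly F} laurent
  laurent_of_poly laurent_of_poly_is_zmod_morphism.
HB.instance Definition _ := GRing.isMonoidMorphism.Build {poly F} laurent
  laurent_of_poly laurent_of_poly_is_monoid_morphism.

End LaurentField.

Section FieldExtensions.
Variables (K L : fieldType) (iota : {rmorphism K -> L}).

(* The subfield of L generated by [iota @` K] and [alpha]. *)
Definition adjoin (alpha : L) : set L := [set y |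
  forall S : {pred L}, GRing.divring_closed S ->
    (forall c, iota c \in S) -> alpha \in S -> y \in S]%classic.

(* [E] has a basis of [n] elements over [K], which acts on [L] through [iota]. *)
Definition has_dim (E : set L) (n : nat) :=
  exists b : 'I_n -> L, (forall i, E (b i)) /\
    forall y, E y -> exists! c : {ffun 'I_n -> K}, y = \sum_i iota (c i) * b i.

End FieldExtensions.

Section FractionField.
Variable R : idomainType.

Local Notation tofrac := (@FracField.tofrac R).

Lemma tofrac_inj : injective tofrac.
Proof. by move=> p q /eqP; rewrite tofrac_eq => /eqP. Qed.

Lemma size_map_tofrac (g : {poly R}) : size (map_poly tofrac g) = size g.
Proof. by rewrite size_map_inj_poly ?rmorph0 //; apply: tofrac_inj. Qed.

Lemma frac_numden (x : {fraction R}) :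
  exists n d : R, d != 0 /\ tofrac d * x = tofrac n.
Proof.
elim/quotW: x => r; exists (frac r).1, (frac r).2.
have r2 := denom_ratioP r; split=> //.
unlock FracField.tofrac; rewrite -[LHS]FracField.pi_mul.
apply/eqmodP; rewrite /= FracField.equivfE /FracField.mulf /=.
by rewrite !numden_Ratio ?mul1r ?mulr1 ?oner_eq0 // mulrC.
Qed.

Lemma clear_denominators (p : {poly {fraction R}}) :
  exists (g : {poly R}) (d : R), d != 0 /\ map_poly tofrac g = tofrac d *: p.
Proof.
elim/poly_ind: p => [|p c [g [d [d0 gp]]]].
  by exists 0, 1; rewrite oner_neq0 rmorph0 scaler0.
have [n [e [e0 ec]]] := frac_numden c.
exists (e *: g * 'X + (d * n)%:P), (d * e); split; first exact: mulf_neq0.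
rewrite rmorphD rmorphM /= map_polyX map_polyC /= map_polyZ /= gp.
rewrite !rmorphM /= -ec scalerDr scalerA scalerAl [X in X *: _]mulrC.
by congr (_ + _); rewrite -mul_polyC -!polyCM mulrA.
Qed.

End FractionField.

Notation ratfun F := {fraction {poly F}}.

Section Heights.
Variables (F L : fieldType) (iota : {rmorphism ratfun F -> L}).
Implicit Types (alpha : L) (f g : {poly {poly F}}).

Local Notation tofrac := (@FracField.tofrac {poly F}).

Definition poly_embed : {rmorphism {poly F} -> L} := iota \o tofrac.

(* In [{poly {poly F}}] the outer indeterminate is x and the inner one is T. *)
Definition is_minimal_poly alpha f :=
  [/\ irreducible_poly (map_poly tofrac f),
      root (map_poly poly_embed f) alpha,
      forall d : {poly F}, (forall i, d %| f`_i) -> size d = 1%N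
    & lead_coef f \is monic].

(* The default value 0 is never reached on algebraic elements, and the chosen
   polynomial is the only candidate: see [minimal_polyP] and
   [minimal_poly_unique]. *)
Definition minimal_poly alpha : {poly {poly F}} :=
  xget 0 [set f | is_minimal_poly alpha f]%classic.

(* [size] and [sizeY] are one more than the degrees in x and in T. *)
Definition height alpha : rat :=
  (sizeY (minimal_poly alpha)).-1%:R / (size (minimal_poly alpha)).-1%:R.

Definition totally_T_adic alpha :=
  let f := map_poly (@laurent_of_poly F) (minimal_poly alpha) in
  exists rs : seq (laurent F), f = lead_coef f *: \prod_(r <- rs) ('X - r%:P).

Definition is_constant alpha := algebraicOver (poly_embed \o polyC) alpha.

Lemma map_poly_embed g :
  map_poly poly_embed g = map_poly iota (map_poly tofrac g).
Proof. by rewrite -map_poly_comp. Qed.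

Lemma root_poly_embedZ alpha (d : {poly F}) g : d != 0 ->
  root (map_poly poly_embed (d *: g)) alpha = root (map_poly poly_embed g) alpha.
Proof. by move=> d0; rewrite map_polyZ rootZ // fmorph_eq0 tofrac_eq0. Qed.

Lemma minimal_poly_unique alpha f g :
  is_minimal_poly alpha f -> is_minimal_poly alpha g -> f = g.
Proof.
move=> [fI fr fc fm] [gI gr gc gm]; pose h := gcdp (map_poly tofrac f) (map_poly tofrac g).
have h1 : size h != 1%N.
  apply/negP => co; have : coprimep (map_poly poly_embed f) (map_poly poly_embed g).
    by rewrite !map_poly_embed coprimep_map.
  by move=> /coprimep_root/(_ fr)/eqP; apply; apply/eqP.
have /eqpf_eq[c c0 fcg] : map_poly tofrac f %= map_poly tofrac g.
  apply: (@eqp_trans _ h); last by apply: gI.2; rewrite ?dvdp_gcdr.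
  by rewrite eqp_sym; apply: fI.2; rewrite ?dvdp_gcdl.
have [n [d [d0 dc]]] := frac_numden c.
have dfng : d *: f = n *: g.
  apply: (map_inj_poly (@tofrac_inj _) (rmorph0 _)).
  by rewrite !map_polyZ /= fcg scalerA dc.
pose k := gcdp d n; have k0 : k != 0 by rewrite gcdp_eq0 negb_and d0.
have co : coprimep (d %/ k) (n %/ k) by apply: coprimep_div_gcd; rewrite d0.
have {}dfng : (d %/ k) *: f = (n %/ k) *: g.
  apply: (@mulfI _ k%:P); first by rewrite polyC_eq0.
  rewrite !mul_polyC !scalerA ![k * _]mulrC.
  by rewrite !divpK ?dvdp_gcdl ?dvdp_gcdr.
have /eqP/size_poly1P[a a0 da] : size (d %/ k) = 1%N.
  apply: gc => i; rewrite -(Gauss_dvdpr _ co); apply/dvdpP; exists f`_i.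
  by rewrite [RHS]mulrC -!coefZ dfng.
have /eqP/size_poly1P[b b0 nb] : size (n %/ k) = 1%N.
  apply: fc => i; rewrite coprimep_sym in co.
  rewrite -(Gauss_dvdpr _ co); apply/dvdpP; exists g`_i.
  by rewrite [RHS]mulrC -!coefZ dfng.
have /(congr1 (fun p : {poly {poly F}} => lead_coef (lead_coef p))) := dfng.
rewrite !lead_coefZ !lead_coefM (monicP fm) (monicP gm) !mulr1 da nb !lead_coefC.
move=> ab; have bP0 : b%:P%:P != 0 :> {poly {poly F}} by rewrite !polyC_eq0.
by rewrite da nb in dfng; apply: (mulfI bP0); rewrite !mul_polyC -dfng ab.
Qed.

Lemma minimal_poly_exists alpha :
  algebraicOver iota alpha -> exists f, is_minimal_poly alpha f.
Proof.
pose good g := g != 0 /\ root (map_poly poly_embed g) alpha.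
have clear (p : {poly ratfun F}) : p != 0 -> root (map_poly iota p) alpha ->
    exists2 g, good g & size g = size p.
  move=> p0 pr; have [g [d [d0 gp]]] := clear_denominators p.
  have td0 : tofrac d != 0 by rewrite tofrac_eq0.
  have sg : size g = size p by rewrite -size_map_tofrac gp size_scale.
  exists g => //; split; first by rewrite -size_poly_eq0 sg size_poly_eq0.
  by rewrite map_poly_embed gp map_polyZ rootZ ?fmorph_eq0.
move=> [p p0 /(clear p p0)[g0 g0P _]].
have exn : exists n, `[< exists2 g, good g & size g = n >].
  by exists (size g0); apply/asboolP; exists g0.
case: (ex_minnP exn) => n /asboolP[{}g0 {}g0P g0n] nmin.
have sizeK (q : {poly ratfun F}) :
    q != 0 -> root (map_poly iota q) alpha -> (n <= size q)%N.
  by move=> q0 /(clear q q0)[g gP <-]; apply/nmin/asboolP; exists g.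
pose good_n g := good g /\ size g = n.
have exm : exists m, `[< exists2 g, good_n g & size (lead_coef g) = m >].
  by exists (size (lead_coef g0)); apply/asboolP; exists g0.
case: (ex_minnP exm) => m /asboolP[g [[g0' gr] gn] gm] mmin.
pose l := lead_coef (lead_coef g).
have l0 : l != 0 by rewrite !lead_coef_eq0.
have lP0 : (l^-1)%:P != 0 :> {poly F} by rewrite polyC_eq0 invr_eq0.
pose f := (l^-1)%:P *: g; exists f.
have fn : size f = n by rewrite size_scale.
have f0 : f != 0 by rewrite -size_poly_eq0 fn -gn size_poly_eq0.
have fr : root (map_poly poly_embed f) alpha by rewrite root_poly_embedZ.
have fm : size (lead_coef f) = m.
  by rewrite lead_coefZ mul_polyC size_scale ?invr_eq0.
have fmon : lead_coef f \is monic.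
  by rewrite monicE lead_coefZ lead_coefM lead_coefC mulVf.
clearbody f; split=> //.
- split; first by rewrite -(size_map_poly iota) -map_poly_embed (root_size_gt1 _ fr) //
    map_poly_embed map_poly_eq0 -size_poly_eq0 size_map_tofrac size_poly_eq0.
  move=> q q1 qf; have tf0 : map_poly tofrac f != 0.
    by rewrite -size_poly_eq0 size_map_tofrac size_poly_eq0.
  have [r fqr] := dvdpP _ _ qf.
  have /andP[r0 q0] : (r != 0) && (q != 0) by rewrite -negb_or -mulf_eq0 -fqr.
  have sz : n = (size r + size q).-1 by rewrite -fn -(size_map_tofrac f) fqr size_mul.
  have [sr sq] : (0 < size r)%N /\ (0 < size q)%N by rewrite !size_poly_gt0.
  move: fr; rewrite map_poly_embed fqr rmorphM /= rootM => /orP[] /sizeK.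
    move=> /(_ r0); rewrite sz -subn1 leq_subLR addnC leq_add2r => nr.
    by case/negP: q1; rewrite eqn_leq sq andbT.
  move=> /(_ q0); rewrite sz -subn1 leq_subLR leq_add2r => nq.
  rewrite -fqr -(dvdp_size_eqp qf) size_map_tofrac fn sz.
  by have -> : size r = 1%N by apply/eqP; rewrite eqn_leq sr andbT.
- move=> d dvd; have d0 : d != 0.
    apply/eqP => dz; case/eqP: f0; apply/polyP => i; rewrite coef0.
    by apply/eqP; have := dvd i; rewrite dz dvd0p.
  pose h := \poly_(i < size f) (f`_i %/ d).
  have fdh : f = d *: h.
    apply/polyP => i; rewrite coefZ /h coef_poly; case: ltnP => [_|si].
      by rewrite mulrC divpK.
    by rewrite mulr0 nth_default.
  clearbody h; have h0 : h != 0.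
    by apply: contraNneq f0 => h0; rewrite fdh h0 scaler0.
  have hP : good_n h.
    split; last by rewrite -fn fdh size_scale.
    by split=> //; rewrite -(root_poly_embedZ _ _ d0) -fdh.
  have := mmin (size (lead_coef h)) (asboolT (ex_intro2 _ _ h hP erefl)).
  rewrite -fm fdh lead_coefZ size_mul ?lead_coef_eq0 //.
  rewrite -subn1 leq_subLR leq_add2r => d1.
  by apply/eqP; rewrite eqn_leq d1 size_poly_gt0.
Qed.

Lemma minimal_polyP alpha :
  algebraicOver iota alpha -> is_minimal_poly alpha (minimal_poly alpha).
Proof. by move=> /minimal_poly_exists; apply: xgetPex. Qed.

End Heights.

(* Main.v *)
Require Import Defs.
From mathcomp Require Import all_boot all_order all_algebra all_field.
From mathcomp Require Import boolp.
From mathcomp Require Import zify ring.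
Set Implicit Arguments.
Unset Strict Implicit.
Unset Printing Implicit Defensive.
Import Order.TTheory GRing.Theory Num.Theory.
Local Open Scope ring_scope.

(** Let [v] be the order at [T = 0] and [f] the minimal polynomial of a
    nonconstant totally [T]-adic element, of degree [d] in [x] and [m] in [T].
    Each root of [f] in [F((T))] reduces modulo [T] to one of the [q + 1]
    points of the projective line over [F], and the lower bound [m/d >= 1/(q+1)]
    says that at most [m] roots reduce to the same point.  Write [f] as a scalar
    [lambda] times a product of linear forms [b x - a], where [(a : b)] are
    homogeneous coordinates of a root with [a], [b] integral and one of them
    equal to [1].  The product is primitive by Gauss's lemma, hence [lambda] is
    integral.  If [k] roots reduce to [c], then [k] of the forms vanish at [c]
    modulo [T], so [T^k] divides the value [f(c)] (the leading coefficient of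
    [f] when [c] is the point at infinity).  That value is a polynomial in [T]
    of degree at most [m], and it is nonzero because [f] is irreducible and not
    proportional to [x - c]; hence [k <= m].  This is [split_degree_bound].

    Equality forces exactly one root above each point, which suggests
    [f = A + T (A x + 1)] with [A = x^q - x]: modulo [T] it has a simple root at
    every point of [F], and one at infinity.  Such roots lift to [F((T))] by
    successive approximation ([fixed_point]), so [f] splits completely
    ([extremal_poly_splits]).  It is irreducible because it has degree [1] in
    [T] ([pencil_irreducible]): if [beta] is a root of [A + T B] with [A], [B]
    coprime, then [beta] is transcendental over [F] and [T = - A(beta)/B(beta)].
    A relation [h(T, beta) = 0] becomes an identity in [F(x)], with the fraction
    [- A/B] as a root of [h] seen as a polynomial in [T]; as in the
    rational root theorem, [B] divides the leading coefficient, so the degree of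
    [h] in [x] is at least that of [B]. *)

(** * The order of a Laurent series at T = 0 *)

Section LaurentOrder.
Variable F : fieldType.
Implicit Types (x y a b : laurent F) (m n : int).

(** The order is used only through its superlevel sets, so that the zero series
    needs no infinite value. *)
Definition ord_ge n x := zero_below n (lcoef x).

Lemma lcoef0 n : lcoef (0 : laurent F) n = 0. Proof. by []. Qed.
Lemma lcoefN x n : lcoef (- x) n = - lcoef x n. Proof. by []. Qed.
Lemma lcoefD x y n : lcoef (x + y) n = lcoef x n + lcoef y n. Proof. by []. Qed.

Lemma lcoef_sum (I : Type) (r : seq I) (E : I -> laurent F) n :
  lcoef (\sum_(i <- r) E i) n = \sum_(i <- r) lcoef (E i) n.
Proof. by elim/big_rec2: _ => // i _ x _ <-. Qed.

Lemma lcoefM m n x y : ord_ge m x -> ord_ge n y ->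
  lcoef (x * y) (m + n) = lcoef x m * lcoef y n.
Proof.
move=> xm yn; have := cauchy_prodE (k := 0) (K := 1) xm yn isT.
by rewrite coefM big_ord1 !coef_poly /= !addr0.
Qed.

Lemma ord_ge_le m n x : m <= n -> ord_ge n x -> ord_ge m x.
Proof. exact: zero_below_le. Qed.

Lemma ord_ge1 : ord_ge 0 1. Proof. exact: cauchy_one_zero_below. Qed.

Lemma ord_geN n x : ord_ge n x -> ord_ge n (- x).
Proof. by move=> xn i /xn xi; rewrite lcoefN xi oppr0. Qed.

Lemma ord_geD n x y : ord_ge n x -> ord_ge n y -> ord_ge n (x + y).
Proof. by move=> xn yn i ilt; rewrite lcoefD xn ?yn ?addr0. Qed.

Lemma ord_geB n x y : ord_ge n x -> ord_ge n y -> ord_ge n (x - y).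
Proof. by move=> xn yn; apply/ord_geD/ord_geN. Qed.

Lemma ord_geM m n x y : ord_ge m x -> ord_ge n y -> ord_ge (m + n) (x * y).
Proof. exact: cauchy_prod_zero_below. Qed.

Lemma ord_geMl n x y : ord_ge 0 x -> ord_ge n y -> ord_ge n (x * y).
Proof. by rewrite -{2}[n]add0r; apply: ord_geM. Qed.

Lemma ord_ge_sum (I : Type) (r : seq I) (E : I -> laurent F) n :
  (forall i, ord_ge n (E i)) -> ord_ge n (\sum_(i <- r) E i).
Proof. by move=> En; elim/big_ind: _ => // *; apply: ord_geD. Qed.

Lemma ord_ge_eq0 x : (forall n : nat, ord_ge n x) -> x = 0.
Proof.
move=> xn; apply/lcoef_inj/funext => i.
by rewrite lcoef0 (xn (absz (i + 1))) //; lia.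
Qed.

Lemma ord_ge_succ n x : ord_ge n x -> lcoef x n = 0 -> ord_ge (n + 1) x.
Proof.
move=> xn x0 i ilt; have [/eqP -> //|ne] := boolP (i == n); apply: xn; lia.
Qed.

Lemma lead_term_exists x : x != 0 -> exists2 n, ord_ge n x & lcoef x n != 0.
Proof.
move=> x0; apply: contrapT => nex; have [N xN] := lcoef_bounded x.
have step (k : nat) : ord_ge (N + k) x.
  elim: k => [|k IH]; first by rewrite addr0.
  have -> : N + k.+1 = N + k + 1 by lia.
  apply: (ord_ge_succ IH); apply/eqP; apply: contraT => xk.
  by case: nex; exists (N + k).
case/eqP: x0; apply: ord_ge_eq0 => n.
apply: ord_ge_le (step (absz (n - N))); lia.
Qed.

(** The orders of [x] and of its inverse are opposite integers, so a series
    without integral order has an inverse in the maximal ideal. *)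
Lemma ord_geV x : ~ ord_ge 0 x -> ord_ge 1 x^-1.
Proof.
move=> x0; have xn0 : x != 0 by apply: contra_not_neq x0 => ->.
have [n xn xl] := lead_term_exists xn0.
have [m ym yl] : exists2 m, ord_ge m x^-1 & lcoef x^-1 m != 0.
  by apply: lead_term_exists; rewrite invr_eq0.
have := lcoefM xn ym; rewrite divff // => e.
have nm : n + m = 0.
  apply/eqP; apply: contraT => nm; move: e; rewrite /= /cauchy_one (negPf nm).
  by move/esym/eqP; rewrite mulf_eq0 (negPf xl) (negPf yl).
have nlt : n < 0.
  by rewrite ltNge; apply/negP => n0; apply: x0; apply: ord_ge_le xn.
apply: ord_ge_le ym; lia.
Qed.

Lemma ord_ge_poly (p : {poly F}) : ord_ge 0 (laurent_of_poly p).
Proof. by case. Qed.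

Lemma ord_geX : ord_ge 1 (laurent_of_poly 'X : laurent F).
Proof. by case=> [[|n]|n] //= _; rewrite coefX. Qed.

(** A nonzero polynomial is not divisible by a power of [T] exceeding its
    degree: this is what turns orders into bounds on degrees in [T]. *)
Lemma lt_size_of_ord_ge (p : {poly F}) (n : nat) :
  p != 0 -> ord_ge n (laurent_of_poly p) -> (n < size p)%N.
Proof.
move=> p0 pn; rewrite ltnNge; apply/negP => np.
have ltp : (size p).-1%:Z < n%:Z by move: p0; rewrite -size_poly_gt0; lia.
case/negP: p0.
by rewrite -lead_coef_eq0 lead_coefE; apply/eqP/(pn (size p).-1).
Qed.

Lemma laurent_of_poly_inj : injective (@laurent_of_poly F).
Proof.
by move=> p q pq; apply/polyP => i; have /(congr1 (fun x => lcoef x i)) := pq.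
Qed.

End LaurentOrder.

(** * Reduction of the roots to the projective line *)

Section Reduction.
Variable F : fieldType.
Implicit Types (x a b : laurent F) (P Q : {poly (laurent F)}).

Definition integral_poly P := forall i, ord_ge 0 P`_i.

(** Reduction modulo [T]; meaningful on integral polynomials only. *)
Definition residue_poly P : {poly F} :=
  map_poly (fun x => lcoef x 0) P.

Lemma coef_residue_poly P i : (residue_poly P)`_i = lcoef P`_i 0.
Proof. exact: coef_map_id0. Qed.

Lemma integral_polyM P Q :
  integral_poly P -> integral_poly Q -> integral_poly (P * Q).
Proof.
move=> Pi Qi i; rewrite coefM; apply: ord_ge_sum => j.
by apply: ord_geMl; [apply: Pi|apply: Qi].
Qed.

Lemma residue_polyM P Q : integral_poly P -> integral_poly Q ->
  residue_poly (P * Q) = residue_poly P * residue_poly Q.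
Proof.
move=> Pi Qi; apply/polyP => i; rewrite coef_residue_poly !coefM lcoef_sum.
by apply: eq_bigr => j _; rewrite !coef_residue_poly -lcoefM.
Qed.

(** Homogeneous coordinates of [x], normalized so that both are integral and
    one of them is [1]: they can be reduced modulo [T] even if [x] cannot. *)
Definition proj_coords x : laurent F * laurent F :=
  if `[< ord_ge 0 x >] then (x, 1) else (1, x^-1).

(** The projective line over [F] is encoded as [option F], with [None] for the
    point at infinity. *)
Definition residue_point x : option F :=
  if `[< ord_ge 0 x >] then Some (lcoef x 0) else None.

(** A multiple of ['X - x%:P] that stays integral and nonzero modulo [T]. *)
Definition proj_factor x : {poly (laurent F)} :=
  (proj_coords x).2 *: 'X - (proj_coords x).1%:P.

Lemma coef_proj_factor x i : (proj_factor x)`_i =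
  (if i == 1%N then (proj_coords x).2 else 0) -
  (if i == 0%N then (proj_coords x).1 else 0).
Proof.
by rewrite coefB coefZ coefX coefC; case: (i == 1)%N; rewrite ?mulr1 ?mulr0.
Qed.

Lemma proj_coords_integral x :
  ord_ge 0 (proj_coords x).1 /\ ord_ge 0 (proj_coords x).2.
Proof.
rewrite /proj_coords; case: asboolP => [x0|/ord_geV xV]; split=> //=;
  try exact: ord_ge1; exact: ord_ge_le xV.
Qed.

Lemma proj_factor_integral x : integral_poly (proj_factor x).
Proof.
have [a0 b0] := proj_coords_integral x; move=> i; rewrite coef_proj_factor.
by apply: ord_geB; case: ifP.
Qed.

Lemma residue_proj_factor_neq0 x : residue_poly (proj_factor x) != 0.
Proof.
apply/eqP => /polyP e; have := e 1%N; have := e 0%N.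
rewrite !coef_residue_poly !coef_proj_factor !coef0 /= subr0 sub0r.
rewrite /proj_coords; case: asboolP => _ /= /eqP; rewrite ?oppr_eq0 /cauchy_one.
  by move=> _ /eqP; rewrite oner_eq0.
by rewrite oner_eq0.
Qed.

Lemma XsubC_proj_factor x : exists mu, 'X - x%:P = mu *: proj_factor x.
Proof.
rewrite /proj_factor /proj_coords; case: asboolP => [_|x0] /=.
  by exists 1; rewrite !scale1r.
exists x; have xn0 : x != 0 by apply: contra_not_neq x0 => ->.
by rewrite scalerBr scalerA divff // scale1r -mul_polyC -polyCM mulr1.
Qed.

Lemma prod_XsubC_proj_factor (rs : seq (laurent F)) :
  exists mu, \prod_(r <- rs) ('X - r%:P) = mu *: \prod_(r <- rs) proj_factor r.
Proof.
elim: rs => [|r rs [mu IH]]; first by exists 1; rewrite !big_nil scale1r.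
have [nu e] := XsubC_proj_factor r; exists (nu * mu).
by rewrite !big_cons IH {1}e -scalerAl -scalerAr scalerA.
Qed.

(** The form of Gauss's lemma needed here: at a coefficient of [P] that is a
    unit, the product with [mu] has exactly the order of [mu]. *)
Lemma integral_scalar P mu : integral_poly P -> residue_poly P != 0 ->
  integral_poly (mu *: P) -> ord_ge 0 mu.
Proof.
move=> Pi P0 muP; have [->//|mu0] := eqVneq mu 0.
have [n mun mul] := lead_term_exists mu0.
suff n0 : 0 <= n by apply: ord_ge_le mun.
rewrite leNgt; apply/negP => nlt.
have Pl : lcoef P`_(size (residue_poly P)).-1 0 != 0.
  by rewrite -coef_residue_poly -lead_coefE lead_coef_eq0.
have := muP (size (residue_poly P)).-1 n nlt.
have := lcoefM mun (Pi (size (residue_poly P)).-1).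
rewrite addr0 coefZ => -> /eqP.
by rewrite mulf_eq0 (negPf mul) (negPf Pl).
Qed.

(** The value at infinity of a polynomial, made homogeneous in [x], is its
    leading coefficient. *)
Definition poly_value (f : {poly {poly F}}) (c : option F) : {poly F} :=
  if c is Some c then f.[c%:P] else lead_coef f.

Definition proj_value (P : {poly (laurent F)}) (c : option F) : laurent F :=
  if c is Some c then P.[laurent_of_poly c%:P] else lead_coef P.

Lemma lead_coef_proj_factor x : lead_coef (proj_factor x) = (proj_coords x).2.
Proof.
have b0 : (proj_coords x).2 != 0.
  rewrite /proj_coords; case: asboolP => [_|x0]; rewrite ?oner_eq0 //=.
  by rewrite invr_eq0; apply: contra_not_neq x0 => ->.
rewrite lead_coefDl ?lead_coefZ ?lead_coefX ?mulr1 //.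
by rewrite size_polyN size_scale // size_polyX ltnS size_polyC leq_b1.
Qed.

Lemma proj_valueZ mu P c : proj_value (mu *: P) c = mu * proj_value P c.
Proof. by case: c => [c|] /=; rewrite ?hornerZ ?lead_coefZ. Qed.

Lemma proj_value_prod (rs : seq (laurent F)) c :
  proj_value (\prod_(r <- rs) proj_factor r) c =
  \prod_(r <- rs) proj_value (proj_factor r) c.
Proof. by case: c => [c|] /=; rewrite ?horner_prod ?lead_coef_prod. Qed.

Lemma laurent_poly_value f c :
  laurent_of_poly (poly_value f c) =
  proj_value (map_poly (@laurent_of_poly F) f) c.
Proof.
case: c => [c|] /=; first by rewrite -horner_map.
by rewrite lead_coef_map_inj ?rmorph0 //; apply: laurent_of_poly_inj.
Qed.

(** The boolean is coerced to [0] or [1]: the form attached to [x] vanishes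
    modulo [T] at the reduction of [x]. *)
Lemma ord_ge_proj_value c x :
  ord_ge (c == residue_point x) (proj_value (proj_factor x) c).
Proof.
have [a0 b0] := proj_coords_integral x.
have v0 : ord_ge 0 (proj_value (proj_factor x) c).
  case: c => [c|] /=; last by rewrite lead_coef_proj_factor.
  rewrite /proj_factor !hornerE; apply: ord_geB => //.
  by apply: ord_geMl => //; apply: ord_ge_poly.
move: v0; case: eqP => // ->; rewrite /residue_point.
case: asboolP => [x0|nx0] /= v0.
  rewrite -[1%N%:Z]add0r; apply: ord_ge_succ => //.
  rewrite /proj_factor /proj_coords; case: asboolP => // _ /=.
  by rewrite !hornerE lcoefD lcoefN /= coefC subrr.
rewrite lead_coef_proj_factor /proj_coords; case: asboolP => // _.
exact: ord_geV.
Qed.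

End Reduction.

Lemma size_sum_count (T : finType) (S : eqType) (pt : S -> T) (s : seq S) :
  size s = (\sum_(c : T) \sum_(x <- s) (c == pt x))%N.
Proof.
rewrite exchange_big /= -sum1_size; apply: eq_bigr => x _.
by rewrite (bigD1 (pt x)) //= eqxx big1 // => c /negPf ->.
Qed.

(** At each of the [#|F|.+1] points [c], the value of [f] is nonzero, has degree
    at most that of [f] in [T], and is divisible by [T] to the number of
    roots that reduce to [c]. *)
Lemma split_degree_bound (F : finFieldType) (f : {poly {poly F}}) rs :
  let f' := map_poly (@laurent_of_poly F) f in
  f' = lead_coef f' *: \prod_(r <- rs) ('X - r%:P) ->
  (forall c, poly_value f c != 0) ->
  (size rs <= #|F|.+1 * (sizeY f).-1)%N.
Proof.
move=> f' f'E f0; have [mu muE] := prod_XsubC_proj_factor rs.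
pose P := \prod_(r <- rs) proj_factor r; pose lam := lead_coef f' * mu.
have {muE}f'E : f' = lam *: P by rewrite f'E muE scalerA.
have [Pi P0] : integral_poly P /\ residue_poly P != 0.
  rewrite /P; elim: rs {f'E P} => [|r rs [IHi IH0]].
    rewrite big_nil; split=> [i|].
      by rewrite coef1; case: eqP => // _; apply: ord_ge1.
    apply/eqP => /polyP /(_ 0%N); rewrite coef_residue_poly coef1 coef0 /=.
    by rewrite /cauchy_one => /eqP; rewrite oner_eq0.
  rewrite big_cons; have ri := proj_factor_integral r.
  split; first exact: integral_polyM.
  by rewrite residue_polyM // mulf_neq0 // residue_proj_factor_neq0.
have lam0 : ord_ge 0 lam.
  apply: (integral_scalar Pi P0) => i; rewrite -f'E coef_map.
  exact: ord_ge_poly.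
rewrite (size_sum_count (@residue_point F)) -card_option -sum_nat_const.
apply: leq_sum => c _.
have lev : (size (poly_value f c) <= sizeY f)%N.
  by case: (c) => [d|] /=; rewrite ?max_size_evalC ?max_size_lead_coefXY.
rewrite -ltnS; apply: leq_trans (leqSpred _); apply: leq_trans lev.
apply: lt_size_of_ord_ge (f0 c) _.
rewrite laurent_poly_value -/f' f'E proj_valueZ.
apply: ord_geMl => //; rewrite proj_value_prod {f'E Pi P0 lam0 P}.
elim: rs => [|r rs IH]; first by rewrite !big_nil; apply: ord_ge1.
by rewrite !big_cons PoszD; apply: ord_geM => //; apply: ord_ge_proj_value.
Qed.

(** * The lower bound *)

(** A root [c] in [F] would make the irreducible [f] proportional to
    ['X - c], and then [alpha] equal to [c]. *)
Lemma minimal_poly_no_root (F L : fieldType) (iota : {rmorphism ratfun F -> L})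
    (alpha : L) (f : {poly {poly F}}) (c : F) :
  is_minimal_poly iota alpha f -> ~ is_constant iota alpha -> f.[c%:P] != 0.
Proof.
move=> [fI fr _ _] nc; apply/eqP => fc0; apply: nc.
set fK := map_poly _ f in fI; pose ck : ratfun F := FracField.tofrac c%:P.
have dvd : 'X - ck%:P %| fK.
  by rewrite dvdp_XsubCl /root /fK horner_map /= fc0 rmorph0.
have /eqp_root eqr : map_poly iota ('X - ck%:P) %= map_poly iota fK.
  by rewrite eqp_map; apply: fI.2 dvd; rewrite size_XsubC.
move: fr; rewrite map_poly_embed -/fK -eqr rmorphB /= map_polyX map_polyC.
rewrite root_XsubC.
by move=> /eqP ->; apply: (@algebraic_id _ _ (poly_embed iota \o polyC) c).
Qed.

Lemma height_lower_bound (F : finFieldType) (L : fieldType)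
    (iota : {rmorphism ratfun F -> L}) (alpha : L) :
  algebraicOver iota alpha -> totally_T_adic iota alpha ->
  ~ is_constant iota alpha -> 1 / (#|F|%:R + 1) <= height iota alpha.
Proof.
move=> alg [rs fE] nc; have fP := minimal_polyP alg.
rewrite /height; move: fP fE; set f := minimal_poly iota alpha => fP fE.
have [fI _ _ fmon] := fP.
have size_f : (1 < size f)%N by rewrite -size_map_tofrac; exact: fI.1.
have size_f' := size_map_inj_poly (@laurent_of_poly_inj F) (rmorph0 _) f.
have size_rs : (size f).-1 = size rs.
  rewrite -size_f' fE size_scale ?size_prod_XsubC // lead_coef_eq0.
  by rewrite -size_poly_eq0 size_f' -lt0n (ltn_trans _ size_f).
have := split_degree_bound fE; rewrite -size_rs => le.
rewrite ler_pdivlMr; last by rewrite ltr0n; lia.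
rewrite mulrAC ler_pdivrMr ?ltr_wpDl // mul1r mulrC natr1 -natrM ler_nat.
by apply: le => -[c|] /=; [apply: minimal_poly_no_root fP nc|apply: monic_neq0].
Qed.

(** * Polynomials of degree one in T *)

Definition pencil (F : fieldType) (A B : {poly F}) : {poly {poly F}} :=
  map_poly polyC A + 'X *: map_poly polyC B.

Lemma horner_map_pencil (F : fieldType) (R : comNzRingType)
    (g : {rmorphism {poly F} -> R}) (A B : {poly F}) (x : R) :
  (map_poly g (pencil A B)).[x] =
  (map_poly (g \o polyC) A).[x] + g 'X * (map_poly (g \o polyC) B).[x].
Proof.
by rewrite rmorphD /= map_polyZ /= !hornerE -!map_poly_comp.
Qed.

Lemma coef_pencil (F : fieldType) (A B : {poly F}) i :
  (pencil A B)`_i = (A`_i)%:P + 'X * (B`_i)%:P.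
Proof. by rewrite coefD coefZ !coef_map. Qed.

Lemma size_pencil (F : fieldType) (A B : {poly F}) :
  (size A < size B)%N -> size (pencil A B) = size B.
Proof.
move=> ltAB; rewrite /pencil addrC size_polyDl size_scale ?polyX_eq0 //.
  exact: size_map_polyC.
by rewrite !size_map_polyC.
Qed.

Lemma lead_coef_pencil (F : fieldType) (A B : {poly F}) :
  (size A < size B)%N -> lead_coef (pencil A B) = lead_coef B *: 'X.
Proof.
move=> ltAB.
rewrite lead_coefE size_pencil // coef_pencil -lead_coefE nth_default ?add0r.
  by rewrite mulrC mul_polyC.
by rewrite -ltnS prednK // (leq_ltn_trans _ ltAB).
Qed.

(** The rational root theorem for the fraction [t = A / B], read in a ring [R]
    that contains [F[x]] through [phi]: after multiplication by a power of [B],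
    every term of [G(t)] but the leading one is a multiple of [B]. *)
Lemma coprime_root_dvd_lead_coef (F : fieldType) (R : comNzRingType)
    (phi : {rmorphism {poly F} -> R}) (A B : {poly F}) (G : {poly {poly F}})
    (t : R) :
  injective phi -> coprimep A B -> t * phi B = phi A ->
  root (map_poly phi G) t -> B %| lead_coef G.
Proof.
move=> phi_inj coAB tB /rootP Gt; have [->|G0] := eqVneq G 0.
  by rewrite lead_coef0 dvdp0.
pose m := (size G).-1.
have hom : \sum_(j < m.+1) G`_j * A ^+ j * B ^+ (m - j) = 0.
  apply: phi_inj; rewrite rmorph0 rmorph_sum /=.
  transitivity ((map_poly phi G).[t] * phi B ^+ m); last by rewrite Gt mul0r.
  rewrite (horner_coef_wide (n := m.+1)); last first.
    by rewrite /m prednK ?size_poly_gt0 // size_poly.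
  rewrite mulr_suml; apply: eq_bigr => j _.
  rewrite coef_map !rmorphM !rmorphXn /= -tB exprMn.
  rewrite -!mulrA; congr (_ * (_ * _)); rewrite -exprD subnKC //.
  by rewrite -ltnS.
have : B %| lead_coef G * A ^+ m.
  move: hom; rewrite big_ord_recr /= subnn expr0 mulr1 => /eqP.
  rewrite addrC addr_eq0 lead_coefE -/m => /eqP ->.
  rewrite dvdpNr; elim/big_ind: _ => [|p q|]; [exact: dvdp0|exact: dvdp_add|].
  move=> [j jm] _ /=; rewrite -[(m - j)%N]prednK ?subn_gt0 // exprSr.
  by rewrite mulrA dvdp_mulIr.
by rewrite Gauss_dvdpl // coprimep_expr // coprimep_sym.
Qed.

Lemma dvdp_root (R : idomainType) (p q : {poly R}) (x : R) :
  p %| q -> root p x -> root q x.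
Proof. by rewrite -!dvdp_XsubCl => pq /dvdp_trans; apply. Qed.

Section Pencil.
Variables (F : fieldType) (L : closedFieldType).
Variable iota : {rmorphism ratfun F -> L}.
Variables A B : {poly F}.
Hypotheses (coAB : coprimep A B) (ltAB : (size A < size B)%N).
Local Notation emb := (poly_embed iota).
Local Notation cst := (emb \o polyC).

Lemma poly_embed_eval (p : {poly F}) : emb p = (map_poly cst p).[emb 'X].
Proof.
elim/poly_ind: p => [|p c IH]; first by rewrite !rmorph0 horner0.
by rewrite !rmorphD !rmorphM /= map_polyX map_polyC !hornerE -IH.
Qed.

Lemma poly_embed_inj : injective emb.
Proof. exact: inj_comp (fmorph_inj _) (@tofrac_inj _). Qed.

Lemma poly_embed_X_transcendental : ~ algebraicOver cst (emb 'X).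
Proof.
case=> p p0 /rootP; rewrite -poly_embed_eval => /eqP.
by rewrite -(rmorph0 emb) (inj_eq poly_embed_inj) (negPf p0).
Qed.

(* T |-> outer variable *)
(** Evaluation of the outer variable [x] first, with [T] kept formal; the value
    of [T] is substituted last. *)
Lemma horner2_poly_embed (h : {poly {poly F}}) (beta : L) :
  (map_poly emb h).[beta] = (map_poly (map_poly cst) h).[beta%:P].[emb 'X].
Proof.
have := horner_map (horner_eval (emb 'X)) (map_poly (map_poly cst) h) beta%:P.
rewrite /= {2 3}/horner_eval hornerC => <-; rewrite -map_poly_comp.
by congr (_.[_]); apply: eq_map_poly => p; apply: poly_embed_eval.
Qed.

(** As [A] and [B] have no common root, the equation at [beta] is a nontrivial
    polynomial equation for [T] over [F(beta)]; an algebraic [beta] would make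
    [T] algebraic over [F]. *)
Lemma pencil_root_transcendental (beta : L) :
  root (map_poly emb (pencil A B)) beta -> ~ algebraicOver cst beta.
Proof.
move=> fb alg; apply: poly_embed_X_transcendental.
apply: (algebraic_root_polyXY _ alg); exists (pencil A B); last first.
  by rewrite /root -horner2_poly_embed.
rewrite (horner_map_pencil (map_poly cst)) /= map_polyX.
have cstC (p : {poly F}) :
    (map_poly (map_poly cst \o polyC) p).[beta%:P] = (map_poly cst p).[beta]%:P.
  rewrite -[RHS]horner_map -map_poly_comp; congr (_.[_]).
  by apply: eq_map_poly => c /=; rewrite map_polyC.
rewrite !cstC; apply/eqP => /polyP e; have := e 1%N; have := e 0%N.
rewrite !coefD !coefXM !coefC /= addr0 add0r => A0 B0.
have := coAB; rewrite -(coprimep_map cst).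
move=> /coprimep_root/(_ (introT rootP A0)).
by rewrite B0 eqxx.
Qed.

(** Since [beta] is transcendental over [F], evaluation at [beta] embeds [F[x]]
    into [L], where [T] becomes the fraction [- A / B] in lowest terms.  Then
    [B] divides the leading coefficient of [h] as a polynomial in [T]. *)
Lemma pencil_root_degree (beta : L) (h : {poly {poly F}}) :
  root (map_poly emb (pencil A B)) beta -> h != 0 ->
  root (map_poly emb h) beta -> (size B <= size h)%N.
Proof.
move=> fb h0 hb; have nalg := pencil_root_transcendental fb.
pose phi : {rmorphism {poly F} -> L} := horner_eval beta \o map_poly cst.
have phi_inj : injective phi.
  apply: raddf_inj => p p0; apply/eqP; apply: contraT => pn0; case: nalg.
  by exists p => //; apply/rootP.
have tB : emb 'X * phi B = phi (- A).
  apply/eqP; rewrite rmorphN -addr_eq0 addrC; move: fb.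
  by rewrite /root horner_map_pencil.
have coNAB : coprimep (- A) B.
  by rewrite -scaleN1r coprimepZl ?oppr_eq0 ?oner_eq0.
have hswap : root (map_poly phi (swapXY h)) (emb 'X).
  rewrite /root; move: hb; rewrite /root horner2_poly_embed.
  rewrite -horner2_swapXY swapXY_map.
  have := horner_map (horner_eval beta) (map_poly (map_poly cst) (swapXY h))
    (emb 'X)%:P.
  by rewrite /= {2 3}/horner_eval hornerC -map_poly_comp => <-.
have := coprime_root_dvd_lead_coef phi_inj coNAB tB hswap.
have l0 : lead_coef (swapXY h) != 0 by rewrite lead_coef_eq0 swapXY_eq0.
move=> /(dvdp_leq l0) sB; apply: leq_trans sB _.
by apply: leq_trans (max_size_lead_coefXY _) _; rewrite sizeYE swapXYK.
Qed.

(** A factor of positive degree has a root [beta] in [L], which is a root of the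
    pencil too; by the previous bound the factor has full degree. *)
Lemma pencil_irreducible :
  (1 < size B)%N ->
  irreducible_poly (map_poly (@FracField.tofrac _) (pencil A B)).
Proof.
move=> B1; set fK := map_poly _ _.
have size_fK : size fK = size B by rewrite size_map_tofrac size_pencil.
split=> [|p p1 pf]; first by rewrite size_fK.
have B0 : size B != 0%N by case: (size B) B1.
have p0 : p != 0.
  by apply: contraTneq pf => ->; rewrite dvd0p -size_poly_eq0 size_fK.
have [beta pb] : exists beta, root (map_poly iota p) beta.
  by apply/closed_rootP; rewrite size_map_poly.
have fb : root (map_poly emb (pencil A B)) beta.
  by rewrite map_poly_embed; apply: dvdp_root pb; rewrite dvdp_map.
have [h [d [d0 hE]]] := clear_denominators p.
have size_h : size h = size p.
  by rewrite -size_map_tofrac hE size_scale ?tofrac_eq0.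
have h0 : h != 0 by rewrite -size_poly_eq0 size_h size_poly_eq0.
have hb : root (map_poly emb h) beta.
  by rewrite map_poly_embed hE map_polyZ rootZ // fmorph_eq0 tofrac_eq0.
rewrite -(dvdp_size_eqp pf) eqn_leq dvdp_leq // -?size_poly_eq0 size_fK //.
by rewrite -size_h (pencil_root_degree fb h0 hb).
Qed.
End Pencil.

(** * The extremal polynomial *)

Definition frob_poly (F : finFieldType) : {poly F} := 'X^#|F| - 'X.

(** [x^q - x + T (x^(q+1) - x^2 + 1)]: the coefficient of [T] takes the value
    [1] at every point of [F], and its degree [q + 1] puts one more root at
    infinity modulo [T]. *)
Definition extremal_poly (F : finFieldType) : {poly {poly F}} :=
  pencil (frob_poly F) (frob_poly F * 'X + 1).

Section Extremal.
Variable F : finFieldType.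
Local Notation q := #|F|.

Lemma size_frob_poly : size (frob_poly F) = q.+1.
Proof.
have q1 := finNzRing_gt1 F.
by rewrite size_polyDl size_polyXn // size_polyN size_polyX ltnS.
Qed.

Lemma size_frob_poly_MX1 : size (frob_poly F * 'X + 1) = q.+2.
Proof.
by rewrite -polyC1 size_MXaddC -size_poly_eq0 size_frob_poly.
Qed.

Lemma coprime_frob_poly : coprimep (frob_poly F) (frob_poly F * 'X + 1).
Proof.
apply/Bezout_eq1_coprimepP; exists (- 'X, 1) => /=.
by rewrite mul1r addrA mulNr mulrC addNr add0r.
Qed.

Lemma size_extremal_poly : size (extremal_poly F) = q.+2.
Proof. by rewrite size_pencil size_frob_poly_MX1 ?size_frob_poly. Qed.

Lemma coef_extremal_poly i : (extremal_poly F)`_i =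
  ((frob_poly F)`_i)%:P + 'X * ((frob_poly F * 'X + 1)`_i)%:P.
Proof. exact: coef_pencil. Qed.

(** This coefficient is a unit, so the content is trivial. *)
Lemma coef1_extremal_poly : (extremal_poly F)`_1 = -1.
Proof.
have := finNzRing_gt1 F.
rewrite coef_extremal_poly (coefD (frob_poly F * 'X)) coefMX coef1 /frob_poly.
rewrite !coefB !coefXn !coefX /=; case: #|F| => [|[|n]] //= _.
by rewrite !subr0 sub0r addr0 mulr0 addr0 rmorphN.
Qed.

Lemma lead_coef_extremal_poly : lead_coef (extremal_poly F) = 'X.
Proof.
rewrite lead_coef_pencil ?size_frob_poly ?size_frob_poly_MX1 //.
rewrite lead_coefE size_frob_poly_MX1 /= coefD coefMX coef1 /= addr0.
have q1 := finNzRing_gt1 F.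
by rewrite coefB coefXn coefX eqxx gtn_eqF // subr0 scale1r.
Qed.

Lemma sizeY_extremal_poly : sizeY (extremal_poly F) = 2%N.
Proof.
apply/eqP; rewrite eqn_leq; apply/andP; split; last first.
  apply: leq_trans (max_size_lead_coefXY _).
  by rewrite lead_coef_extremal_poly size_polyX.
apply/bigmax_leqP => i _; rewrite coef_extremal_poly.
apply: leq_trans (size_polyD _ _) _; rewrite geq_max mulrC mul_polyC.
rewrite (leq_trans (size_polyC_leq1 _)) // (leq_trans (size_scale_leq _ _)) //.
by rewrite size_polyX.
Qed.

Variables (L : closedFieldType) (iota : {rmorphism ratfun F -> L}).

Lemma extremal_poly_minimal alpha :
  root (map_poly (poly_embed iota) (extremal_poly F)) alpha ->
  is_minimal_poly iota alpha (extremal_poly F).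
Proof.
move=> fa; split=> //.
- apply: (pencil_irreducible iota coprime_frob_poly);
    by rewrite size_frob_poly_MX1 ?size_frob_poly.
- by move=> d /(_ 1%N); rewrite coef1_extremal_poly dvdpNr dvdp1 => /eqP.
- by rewrite lead_coef_extremal_poly monicX.
Qed.
End Extremal.

(** * Successive approximation in the ring of power series *)

Section Hensel.
Variable F : fieldType.
Implicit Types (x y : laurent F).

Lemma ord_geXn x (n : nat) : ord_ge 1 x -> ord_ge n (x ^+ n).
Proof.
move=> x1; elim: n => [|n IH]; first exact: ord_ge1.
rewrite exprS; have -> : n.+1%:Z = 1 + n%:Z by lia.
exact: ord_geM.
Qed.

(** Powers with exponent at least [2] contract the maximal ideal: [x - y] is
    multiplied by a form of positive degree in [x] and [y]. *)
Lemma ord_ge_subXn x y n i : ord_ge 1 x -> ord_ge 1 y -> ord_ge n (x - y) ->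
  ord_ge (n + 1) (x ^+ i.+2 - y ^+ i.+2).
Proof.
move=> x1 y1 xy; rewrite subrXX; apply: ord_geM => //; apply: ord_ge_sum => j.
have le1 : 1 <= (i.+1 - j)%N%:Z + j%:Z by lia.
apply: ord_ge_le le1 _.
by apply: ord_geM; apply: ord_geXn.
Qed.

Section FixedPoint.
Variable P : {poly (laurent F)}.
Hypotheses (Pi : integral_poly P) (P0 : ord_ge 1 P`_0) (P1 : ord_ge 1 P`_1).

Lemma horner_ord_ge1 x : ord_ge 1 x -> ord_ge 1 P.[x].
Proof.
move=> x1; rewrite horner_coef; apply: ord_ge_sum => -[[|i] _] /=.
  by rewrite expr0 mulr1.
apply: ord_geMl; first exact: Pi.
by apply: (ord_ge_le _ (ord_geXn x1)); lia.
Qed.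

Lemma horner_contraction x y n : ord_ge 1 x -> ord_ge 1 y ->
  ord_ge n (x - y) -> ord_ge (n + 1) (P.[x] - P.[y]).
Proof.
move=> x1 y1 xy; rewrite !horner_coef -sumrB; apply: ord_ge_sum => -[i _] /=.
rewrite -mulrBr; case: i => [|[|i]].
- by rewrite subrr mulr0.
- by rewrite addrC; apply: ord_geM.
- by apply: ord_geMl; [apply: Pi|apply: ord_ge_subXn].
Qed.

(** Hensel's lemma for the polynomial [P - 'X], whose reduction modulo [T] has a
    simple root at [0]: the hypotheses make [P] a contraction of the
    maximal ideal, and the iterates of [0] converge. *)
Lemma fixed_point : exists2 y, ord_ge 1 y & P.[y] = y.
Proof.
pose u k := iter k (horner P) 0.
have u1 k : ord_ge 1 (u k) by elim: k => //= k; apply: horner_ord_ge1.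
have uS k : ord_ge k.+1 (u k.+1 - u k).
  elim: k => [|k IH]; first by rewrite subr0; apply: u1.
  have -> : k.+2%:Z = k.+1%:Z + 1 by lia.
  exact: (@horner_contraction (u k.+1) (u k) k.+1).
have uD k d : ord_ge k.+1 (u (k + d)%N - u k).
  elim: d => [|d IH]; first by rewrite addn0 subrr.
  rewrite addnS -[_ - u k](subrKA (u (k + d)%N)); apply: ord_geD IH.
  by apply: ord_ge_le (uS _); lia.
have y1 : zero_below 1 (fun n => lcoef (u (absz n)) n).
  by move=> n n1; apply: u1.
(* The coefficient of T^n is stable from the n-th iterate on. *)
pose y := mk_laurent (ex_intro _ 1 y1 : bounded_below _).
have yu k : ord_ge k.+1 (y - u k).
  move=> n nk; rewrite lcoefD lcoefN /=; have [n0|n0] := ltP n 0.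
    by rewrite !u1 ?subr0 //; lia.
  have -> : k = (absz n + (k - absz n))%N by lia.
  apply/eqP; rewrite -lcoefN -lcoefD -opprB lcoefN oppr_eq0; apply/eqP.
  by apply: uD; lia.
exists y => //; apply/eqP; rewrite -subr_eq0; apply/eqP/ord_ge_eq0 => k.
rewrite -[_ - y](subrKA (u k.+1)); apply: ord_geD;
  apply: (@ord_ge_le _ _ k.+1); try lia.
  have -> : k.+1%:Z = k%:Z + 1 by lia.
  by apply: horner_contraction => //; apply: ord_ge_le (yu k); lia.
by rewrite -opprB; apply: ord_geN; apply: ord_ge_le (yu _); lia.
Qed.
End FixedPoint.

(** The equations of the extremal polynomial near all the points of the
    projective line take this form. *)
Lemma perturbed_power_fixed_point (q : nat) (S : {poly {poly F}}) : (1 < q)%N ->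
  exists2 y, ord_ge 1 y &
    y = y ^+ q + laurent_of_poly 'X * (map_poly (@laurent_of_poly F) S).[y].
Proof.
move=> q1; pose S' := map_poly (@laurent_of_poly F) S.
pose P := 'X^q + laurent_of_poly 'X *: S'.
have Pi i : ord_ge (i != q) P`_i.
  rewrite coefD coefXn coefZ coef_map; apply: ord_geD.
    by case: eqP => // _; apply: ord_ge1.
  have XS : ord_ge (1 + 0) (laurent_of_poly 'X * laurent_of_poly S`_i).
    by apply: ord_geM; [apply: ord_geX|apply: ord_ge_poly].
  by apply: ord_ge_le XS; case: eqP.
have [|||y y1 yP] := @fixed_point P.
- by move=> i; apply: ord_ge_le (Pi i); case: eqP.
- by have := Pi 0%N; case: eqP => // q0; move: q1; rewrite -q0.
- by have := Pi 1%N; case: eqP => // q0; move: q1; rewrite -q0.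
- by exists y => //; rewrite -{1}yP /P !hornerE.
Qed.

End Hensel.

(** * The roots of the extremal polynomial in F((T)) *)

Section Roots.
Variable F : finFieldType.
Local Notation q := #|F|.
Local Notation T := (laurent_of_poly 'X : laurent F).
Local Notation cst c := (laurent_of_poly c%:P : laurent F).

(** [X^q - X] is the product of all the [X - a] with [a] in [F], and a
    translation by [c] permutes these factors. *)
Lemma frob_poly_translate (c : F) (y : laurent F) :
  (y + cst c) ^+ q - (y + cst c) = y ^+ q - y.
Proof.
have E (z : laurent F) : z ^+ q - z = \prod_(a : F) (z - cst a).
  have := finField_genPoly F.
  move/(congr1 (fun p => (map_poly (@laurent_of_poly F \o polyC) p).[z])).
  rewrite rmorphB rmorph_prod /= map_polyXn map_polyX !hornerE => ->.
  rewrite horner_prod; apply: eq_bigr => a _.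
  by rewrite rmorphB /= map_polyX map_polyC !hornerE.
rewrite !E (reindex_inj (addIr c)) /=; apply: eq_bigr => a _.
rewrite polyCD rmorphD /=; ring.
Qed.

Lemma extremal_poly_laurentE (x : laurent F) :
  (map_poly (@laurent_of_poly F) (extremal_poly F)).[x] =
  (x ^+ q - x) + T * ((x ^+ q - x) * x + 1).
Proof.
rewrite horner_map_pencil [map_poly _ (_ * _ + _)]rmorphD rmorphM rmorph1 /=.
rewrite /frob_poly rmorphB /=.
by rewrite map_polyXn map_polyX !hornerE.
Qed.

(** With [x = y + c], the equation reads
    [y = y^q + T ((y^q - y) (y + c) + 1)]. *)
Lemma extremal_root_near (c : F) :
  exists r, [/\ root (map_poly (@laurent_of_poly F) (extremal_poly F)) r,
     ord_ge 0 r & lcoef r 0 = c].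
Proof.
have [y y1 yE] := perturbed_power_fixed_point
  (('X^q - 'X) * ('X + c%:P%:P) + 1) (finNzRing_gt1 F).
exists (y + cst c); split.
- rewrite /root extremal_poly_laurentE frob_poly_translate.
  move: yE; rewrite rmorphD rmorphM rmorphB rmorphD rmorph1 /=.
  rewrite map_polyXn map_polyX map_polyC !hornerE /= => yE.
  by apply/eqP; rewrite [X in _ - X + _]yE; ring.
- by apply: ord_geD (ord_ge_poly _); apply: ord_ge_le y1.
- by rewrite lcoefD y1 // add0r /= coefC.
Qed.

(** With [x = y^-1], the equation multiplied by [y^(q+1)] reads
    [y = y^q + T (y^(q-1) - 1 - y^(q+1))]; its solution in the maximal ideal is
    nonzero because the right-hand side is [- T] at [y = 0]. *)
Lemma extremal_root_infinity :
  exists2 r, root (map_poly (@laurent_of_poly F) (extremal_poly F)) r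
    & ~ ord_ge 0 r.
Proof.
have q1 := finNzRing_gt1 F.
have [y y1 yE] :=
  @perturbed_power_fixed_point F q ('X^(q.-1) - 1 - 'X^(q.+1)) q1.
rewrite !rmorphB rmorph1 /= !map_polyXn !hornerE in yE.
have y0 : y != 0.
  have T0 : T != 0.
    rewrite -(rmorph0 (@laurent_of_poly F)) (inj_eq (@laurent_of_poly_inj F)).
    by rewrite polyX_eq0.
  apply: contraNneq T0 => y0; move: yE; rewrite y0 !expr0n.
  rewrite -subn1 subn_eq0 [(q <= 1)%N]leqNgt q1 gtn_eqF ?(ltnW q1) //.
  by rewrite !add0r subr0 mulrN1 => /esym/eqP; rewrite oppr_eq0.
exists y^-1.
  rewrite /root extremal_poly_laurentE exprVn; move: q1 yE.
  (* With q = n + 2, all the powers are polynomials in y and z = y^n. *)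
  case: #|F| => [|[|n]] //= _ yE.
  have z0 : y ^+ n != 0 by rewrite expf_neq0.
  move: yE; rewrite !exprS; set z := y ^+ n => yE.
  apply/eqP; transitivity ((y -
    (y * (y * z) + T * (y * z - 1 - y * (y * (y * z))))) / (y ^+ 3 * z)).
    by field; rewrite y0 z0.
  by rewrite -yE subrr mul0r.
move=> yV; have := ord_geM y1 yV; rewrite divff // => /(_ 0 isT) /eqP.
by rewrite /= oner_eq0.
Qed.

(** The [q + 1] roots found are distinct since their reductions are. *)
Lemma extremal_poly_splits :
  let f' := map_poly (@laurent_of_poly F) (extremal_poly F) in
  exists rs : seq (laurent F), f' = lead_coef f' *: \prod_(r <- rs) ('X - r%:P).
Proof.
move=> f'; have sf : size f' = q.+2.
  rewrite (size_map_inj_poly (@laurent_of_poly_inj _)) ?rmorph0 //.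
  exact: size_extremal_poly.
have [ri ri0 rio] := extremal_root_infinity.
have [r rP] := choice extremal_root_near.
exists (ri :: [seq r c | c <- enum F]); apply: all_roots_prod_XsubC.
- by rewrite sf /= size_map -cardE.
- apply/andP; split=> //; apply/allP => _ /mapP[c _ ->].
  by have [] := rP c.
- rewrite uniq_rootsE /=; apply/andP; split.
    by apply/mapP => -[c _ e]; apply: rio; rewrite e; have [] := rP c.
  rewrite map_inj_uniq ?enum_uniq // => c d cd.
  by have [_ _ <-] := rP c; have [_ _ <-] := rP d; rewrite cd.
Qed.
End Roots.

(** * The degree of a simple extension *)

(** The powers of [alpha] below the degree of [p] form a basis.  They span
    because the values at [alpha] of polynomials are closed under division, by
    a Bezout relation with the irreducible [p]; they are independent because a
    polynomial of smaller degree is coprime to [p]. *)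
Lemma has_dim_adjoin (K L : fieldType) (iota : {rmorphism K -> L})
    (alpha : L) (p : {poly K}) :
  irreducible_poly p -> root (map_poly iota p) alpha ->
  has_dim iota (adjoin iota alpha) (size p).-1.
Proof.
move=> pI pr; set n := (size p).-1.
have p0 : p != 0 by rewrite -size_poly_gt0 (ltn_trans _ pI.1).
have sp : size p = n.+1 by rewrite /n prednK // size_poly_gt0.
pose ev (g : {poly K}) := (map_poly iota g).[alpha].
have evB g h : ev (g - h) = ev g - ev h by rewrite /ev rmorphB !hornerE.
have evM g h : ev (g * h) = ev g * ev h by rewrite /ev rmorphM !hornerE.
have ev_sum (c : 'I_n -> K) (g : {poly K}) :
    (forall i : 'I_n, g`_i = c i) -> (size g <= n)%N ->
  ev g = \sum_i iota (c i) * alpha ^+ i.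
  move=> gc sg; rewrite /ev (@horner_coef_wide _ n) ?size_map_poly //.
  by apply: eq_bigr => i _; rewrite coef_map gc.
have inj g : ev g = 0 -> (size g <= n)%N -> g = 0.
  move=> g0 sg; apply/eqP; apply: contraT => gn0.
  have : coprimep p g.
    rewrite (irreducible_poly_coprime _ pI); apply/negP => /(dvdp_leq gn0).
    by rewrite sp leqNgt ltnS sg.
  rewrite -(coprimep_map iota) => /coprimep_root /(_ pr).
  by rewrite -/(ev g) g0 eqxx.
exists (fun i => alpha ^+ i); split=> [i S [S1 SB SV] _ Sa | y].
  have SM x z : x \in S -> z \in S -> x * z \in S.
    move=> xS zS; have zV := SV 1 z S1 zS.
    by have := SV x _ xS zV; rewrite mul1r invrK.
  by elim: (i : nat) => [|k IH]; rewrite ?expr0 // exprS; apply: SM.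
pose S : {pred L} := [pred y | `[< exists g, y = ev g >]].
have SP z : reflect (exists g, z = ev g) (z \in S) by apply: asboolP.
move=> /(_ S) Sy; have {Sy} /SP[g yE] : y \in S.
  apply: Sy.
  - split.
    + by apply/SP; exists 1; rewrite /ev rmorph1 hornerE.
    + by move=> _ _ /SP[g ->] /SP[h ->]; apply/SP; exists (g - h).
    + move=> _ _ /SP[g ->] /SP[h ->]; apply/SP.
      have [ph|ph] := boolP (p %| h).
        exists 0; have -> : ev h = 0.
          by apply/rootP; apply: dvdp_root pr; rewrite dvdp_map.
        by rewrite invr0 mulr0 /ev rmorph0 horner0.
      have : coprimep p h by rewrite (irreducible_poly_coprime _ pI).
      case/Bezout_eq1_coprimepP => -[u v] /= uv; exists (g * v).
      have uvE : ev h * ev v = 1.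
        have := congr1 ev uv; rewrite /ev rmorphD !rmorphM rmorph1 !hornerE.
        by rewrite (rootP pr) mulr0 add0r mulrC.
      have h0 : ev h != 0.
        by apply: contra_eq_neq uvE => ->; rewrite mul0r eq_sym oner_eq0.
      by rewrite evM; congr (_ * _); apply: (mulfI h0); rewrite uvE divff.
  - by move=> c; apply/SP; exists c%:P; rewrite /ev map_polyC hornerC.
  - by apply/SP; exists 'X; rewrite /ev map_polyX hornerX.
pose r := g %% p.
have sr : (size r <= n)%N by rewrite -ltnS -sp ltn_modp.
have yr : y = ev r.
  rewrite yE {1}(divp_eq g p) /ev rmorphD rmorphM !hornerE (rootP pr).
  by rewrite mulr0 add0r.
exists [ffun i : 'I_n => r`_i]; split.
  rewrite yr (ev_sum (fun i => r`_i)) //.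
  by apply: eq_bigr => i _; rewrite ffunE.
move=> c yc; pose g' := \poly_(i < n) (if insub i is Some j then c j else 0).
have g'c (i : 'I_n) : g'`_i = c i by rewrite coef_poly ltn_ord valK.
have sg' : (size g' <= n)%N by apply: size_poly.
have /eqP : r - g' = 0.
  apply: inj; first by rewrite evB -yr (ev_sum c g') // -yc subrr.
  by rewrite (leq_trans (size_polyD _ _)) // geq_max size_polyN sr sg'.
by rewrite subr_eq0 => /eqP rg; apply/ffunP => i; rewrite ffunE rg g'c.
Qed.

(** * The sharp bound *)

Theorem theoremA (q : nat) (Fq : finFieldType) (cardFq : #|Fq| = q)
    (L : closedFieldType) (iota : {rmorphism ratfun Fq -> L})
    (L_algebraic : forall x : L, algebraicOver iota x) :
  (forall alpha : L, totally_T_adic iota alpha -> ~ is_constant iota alpha ->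
     1 / (q%:R + 1) <= height iota alpha) /\
  (exists alpha : L, [/\ totally_T_adic iota alpha,
     has_dim iota (adjoin iota alpha) (q + 1)%N &
     height iota alpha = 1 / (q%:R + 1)]).
Proof.
subst q; split=> [alpha aT nc|]; first exact: height_lower_bound.
have [alpha fa] :
    exists alpha, root (map_poly (poly_embed iota) (extremal_poly Fq)) alpha.
  apply/closed_rootP; rewrite size_map_inj_poly ?rmorph0 ?size_extremal_poly //.
  exact: poly_embed_inj.
have fmin := extremal_poly_minimal fa.
have fE : minimal_poly iota alpha = extremal_poly Fq.
  exact: minimal_poly_unique (minimal_polyP (L_algebraic alpha)) fmin.
exists alpha; split.
- by rewrite /totally_T_adic fE; apply: extremal_poly_splits.
- have [fI _ _ _] := fmin; have := @has_dim_adjoin _ _ iota alpha _ fI.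
  by rewrite -map_poly_embed size_map_tofrac size_extremal_poly addn1; apply.
- by rewrite /height fE sizeY_extremal_poly size_extremal_poly /= natr1.
Qed.
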